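(* Let $\mathcal{C}\subseteq\mathbb{R}^n$ be non-empty, closed and convex, $\mathcal{K}:\mathcal{C}\rightrightarrows\mathbb{R}^n$ a set-valued map, and $\mathcal{A}=\overline{\mathrm{co}}(\mathcal{K}(\mathcal{C}))$. Suppose $f:\mathcal{A}\times\mathcal{A}\to\mathbb{R}$ is strictly monotone, i.e. $f(x,y)+f(y,x)<0$ for all $x,y\in\mathcal{A}$ with $x\neq y$, and satisfies: (A1) $f(\cdot,y)$ is upper semicontinuous for all $y\in\mathcal{A}$, $f(x,\cdot)$ is continuous and convex for all $x\in\mathcal{A}$, and $f(x,x)=0$ for all $x\in\mathcal{A}$; (A3) for any sequence $(u_m)_{m\in\mathbb{N}}\subset\mathcal{A}$ with $\lim_m\|u_m\|=\infty$ there exist $z\in\mathcal{A}$ and $m_0\in\mathbb{N}$ such that $f(u_m,z)\le0$ for all $m\ge m_0$. Assume that $\mathcal{K}$ is a closed, lower semicontinuous map with non-empty closed convex values, and that the set $$S^*=\Big\{\bar y\in\bigcap_{z\in\mathcal{C}}\mathcal{K}(z)\;\Big|\; f(\bar y,y)\ge0\ \ \forall\,y\in\bigcup_{z\in\mathcal{C}}\mathcal{K}(z)\Big\}$$ is non-empty. Let $(\gamma_k)$ be a bounded sequence of positive reals, $y_0\in\mathbb{R}^n$, and let $(y_k)$ be the sequence generated by the proximal point algorithm described in the context. Then $(y_k)$ converges to a point $\bar y$ such that $P_{\mathcal{C}}(\bar y)$ is the projected solution of QEP$(f,\mathcal{K})$.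
   Context: $P_{\mathcal{C}}$ is the Euclidean projection onto $\mathcal{C}$; $\overline{\mathrm{co}}$ is the closure of the convex hull; $\mathcal{K}(\mathcal{C})=\bigcup_{x\in\mathcal{C}}\mathcal{K}(x)$. Projected solution: $\bar x\in\mathcal{C}$ is a projected solution of QEP$(f,\mathcal{K})$ if there is $\bar y\in\mathcal{K}(\bar x)$ with $\|\bar x-\bar y\|=\inf_{y\in\mathcal{C}}\|y-\bar y\|$ (i.e. $\bar x=P_{\mathcal{C}}(\bar y)$) and $f(\bar y,y)\ge0$ for all $y\in\mathcal{K}(\bar x)$. $\mathcal{K}$ is closed if $x_k\to x$ in $\mathcal{C}$, $y_k\in\mathcal{K}(x_k)$, $y_k\to y$ imply $y\in\mathcal{K}(x)$. $\mathcal{K}$ is lower semicontinuous if for every sequence $(x_k)\subset\mathcal{C}$ with $x_k\to x$ and every $y\in\mathcal{K}(x)$ there are $y_k\in\mathcal{K}(x_k)$ with $y_k\to y$. Proximal point algorithm: for $k=0,1,2,\dots$ let $x_k=P_{\mathcal{C}}(y_k)$, let $f_k(x,y)=f(x,y)+\gamma_k\langle x-y_k,y-x\rangle$ for $x,y\in\mathcal{A}$, and let $y_{k+1}$ be the unique point of $\mathcal{K}(x_k)$ such that $f_k(y_{k+1},y)\ge0$ for all $y\in\mathcal{K}(x_k)$ (such a point exists and is unique under the assumptions on $f$). The stopping test is disregarded, so $(y_k)$ is an infinite sequence. *)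

(* Defs.v *)
From mathcomp Require Export all_boot all_order all_algebra.
From mathcomp Require Export all_classical all_reals all_analysis.
Export Order.TTheory GRing.Theory Num.Theory.
Export numFieldNormedType.Exports.

Set Implicit Arguments.
Unset Strict Implicit.
Unset Printing Implicit Defensive.

Local Open Scope classical_set_scope.
Local Open Scope ring_scope.

(* R^n is 'rV[R]_n.  Its library topology is the usual one, but its library
   norm `|x| is the sup norm, hence the Euclidean structure below. *)

Definition edot (R : realType) (n : nat) (u v : 'rV[R]_n) : R :=
  \sum_(i < n) u 0 i * v 0 i.

Definition enorm (R : realType) (n : nat) (u : 'rV[R]_n) : R :=
  Num.sqrt (edot u u).

Definition is_proj (R : realType) (n : nat) (C : set 'rV[R]_n)
    (y x : 'rV[R]_n) : Prop :=
  C x /\ enorm (x - y) = inf [set enorm (z - y) | z in C].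

(* The default value of [xget] is only reached when no nearest point exists,
   which does not happen for C non-empty, closed and convex. *)
Definition proj (R : realType) (n : nat) (C : set 'rV[R]_n)
    (y : 'rV[R]_n) : 'rV[R]_n :=
  xget 0 [set x | is_proj C y x].

Definition closed_convex_hull (R : realType) (n : nat) (S : set 'rV[R]_n) :
    set 'rV[R]_n :=
  closure (smallest (fun B : set 'rV[R]_n => convex_set B) S).

(* A set-valued map C => R^n is a function K on all of 'rV[R]_n, and a
   bifunction on A x A is a function f on all pairs; their values outside
   C, respectively A x A, are never constrained nor used. *)

Definition Kimage (R : realType) (n : nat) (C : set 'rV[R]_n)
    (K : 'rV[R]_n -> set 'rV[R]_n) : set 'rV[R]_n :=
  \bigcup_(x in C) K x.

Definition closed_map (R : realType) (n : nat) (C : set 'rV[R]_n)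
    (K : 'rV[R]_n -> set 'rV[R]_n) : Prop :=
  forall (x_ y_ : nat -> 'rV[R]_n) (x y : 'rV[R]_n),
    (forall k, C (x_ k)) -> C x -> x_ @ \oo --> x ->
    (forall k, K (x_ k) (y_ k)) -> y_ @ \oo --> y -> K x y.

Definition lsc_map (R : realType) (n : nat) (C : set 'rV[R]_n)
    (K : 'rV[R]_n -> set 'rV[R]_n) : Prop :=
  forall (x_ : nat -> 'rV[R]_n) (x : 'rV[R]_n),
    (forall k, C (x_ k)) -> C x -> x_ @ \oo --> x ->
    forall y, K x y ->
    exists2 y_ : nat -> 'rV[R]_n,
      forall k, K (x_ k) (y_ k) & y_ @ \oo --> y.

Definition usc_on (R : realType) (n : nat) (A : set 'rV[R]_n)
    (g : 'rV[R]_n -> R) : Prop :=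
  forall x, A x -> forall a, g x < a ->
    \forall z \near within A (nbhs x), g z < a.

Definition strictly_monotone (R : realType) (n : nat) (A : set 'rV[R]_n)
    (f : 'rV[R]_n -> 'rV[R]_n -> R) : Prop :=
  forall x y, A x -> A y -> x != y -> f x y + f y x < 0.

Definition assumption_A1 (R : realType) (n : nat) (A : set 'rV[R]_n)
    (f : 'rV[R]_n -> 'rV[R]_n -> R) : Prop :=
  [/\ forall y, A y -> usc_on A (fun x => f x y),
      forall x, A x -> {within A, continuous (f x)},
      forall x, A x -> convex_function A (f x)
    & forall x, A x -> f x x = 0].

Definition assumption_A3 (R : realType) (n : nat) (A : set 'rV[R]_n)
    (f : 'rV[R]_n -> 'rV[R]_n -> R) : Prop :=
  forall u : nat -> 'rV[R]_n,
    (forall m, A (u m)) -> enorm (u m) @[m --> \oo] --> +oo ->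
    exists2 z, A z & exists m0 : nat, forall m, (m0 <= m)%N -> f (u m) z <= 0.

Definition projected_solution (R : realType) (n : nat) (C : set 'rV[R]_n)
    (K : 'rV[R]_n -> set 'rV[R]_n) (f : 'rV[R]_n -> 'rV[R]_n -> R)
    (xbar : 'rV[R]_n) : Prop :=
  C xbar /\
  exists ybar, [/\ K xbar ybar,
    enorm (xbar - ybar) = inf [set enorm (y - ybar) | y in C]
    & forall y, K xbar y -> 0 <= f ybar y].

Definition Sstar (R : realType) (n : nat) (C : set 'rV[R]_n)
    (K : 'rV[R]_n -> set 'rV[R]_n) (f : 'rV[R]_n -> 'rV[R]_n -> R) :
    set 'rV[R]_n :=
  [set ybar | (\bigcap_(z in C) K z) ybar /\
              forall y, (\bigcup_(z in C) K z) y -> 0 <= f ybar y].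

Definition regularized (R : realType) (n : nat)
    (f : 'rV[R]_n -> 'rV[R]_n -> R) (c : R) (w : 'rV[R]_n)
    (x y : 'rV[R]_n) : R :=
  f x y + c * edot (x - w) (y - x).

Definition proximal_sequence (R : realType) (n : nat) (C : set 'rV[R]_n)
    (K : 'rV[R]_n -> set 'rV[R]_n) (f : 'rV[R]_n -> 'rV[R]_n -> R)
    (gamma : nat -> R) (y0 : 'rV[R]_n) (y_ : nat -> 'rV[R]_n) : Prop :=
  y_ 0%N = y0 /\
  forall k, let x_k := proj C (y_ k) in
    K x_k (y_ k.+1) /\
    forall y, K x_k y -> 0 <= regularized f (gamma k) (y_ k) (y_ k.+1) y.

(* Main.v *)
Require Import Defs.
From mathcomp Require Import ring lra.

(* Fix s in S*.  Testing the proximal step against s shows that |y_k - s|^2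
   decreases and that -f(y_{k+1}, s) is at most a bounded multiple of its
   decrement, which tends to 0; moreover f(s, y_{k+1}) >= 0.  Hence any cluster
   point p of the bounded sequence satisfies f(p, s) >= 0 and
   f(s, p) >= 0, so p = s by strict monotonicity, and y_k -> s.  The same
   argument identifies with s any point realising a projected solution. *)

Set Implicit Arguments.
Unset Strict Implicit.
Unset Printing Implicit Defensive.

Local Open Scope classical_set_scope.
Local Open Scope ring_scope.

Lemma continuous_sum_sqr_sub (R : realType) (T : topologicalType) (I : Type)
    (r : seq I) (F : I -> T -> R) (c : I -> R) :
  (forall i, continuous (F i)) ->
  continuous (fun x => \sum_(i <- r) (F i x - c i) ^+ 2).
Proof.
move=> Fc x; rewrite /continuous_at; elim: r => [|i r IH].
  by under eq_fun do rewrite big_nil; rewrite big_nil; exact: cvg_cst.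
rewrite big_cons; under eq_fun => v do rewrite big_cons.
apply: cvgD IH; under eq_fun do rewrite expr2; rewrite expr2.
by apply: cvgM; (apply: cvgB; [exact: Fc|exact: cvg_cst]).
Qed.

Section Euclidean.
Context {R : realType} {n : nat}.
Implicit Types (u v w x y z : 'rV[R]_n) (C : set 'rV[R]_n).

Lemma edot_ge0 u : 0 <= edot u u.
Proof. by apply: sumr_ge0 => i _; rewrite -expr2 sqr_ge0. Qed.

Lemma edot_coord_le u i : u 0 i ^+ 2 <= edot u u.
Proof.
rewrite /edot (bigD1 i)//= -expr2 lerDl.
by apply: sumr_ge0 => j _; rewrite -expr2 sqr_ge0.
Qed.

Lemma edot_le0_eq0 u : edot u u <= 0 -> u = 0.
Proof.
move=> u0; apply/rowP => i; rewrite mxE; apply/eqP; rewrite -sqrf_eq0.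
by rewrite eq_le sqr_ge0 andbT (le_trans (edot_coord_le u i)).
Qed.

(** Law of cosines. With [y_ k], [y_ k.+1], [s] for [u], [v], [w], it turns the proximal term into a
    decrement of the squared distance to [s]. *)
Lemma edot_polarization u v w :
  2 * edot (v - u) (w - v) =
  edot (u - w) (u - w) - edot (v - w) (v - w) - edot (v - u) (v - u).
Proof.
rewrite /edot mulr_sumr -!sumrB; apply: eq_bigr => i _; rewrite !mxE; ring.
Qed.

(** Parallelogram identity for [u - w] and [v - w]; it yields uniqueness of the projection. *)
Lemma edot_midpoint u v w :
  4 * edot (2^-1 *: u + 2^-1 *: v - w) (2^-1 *: u + 2^-1 *: v - w) =
  2 * edot (u - w) (u - w) + 2 * edot (v - w) (v - w) - edot (u - v) (u - v).
Proof.
rewrite /edot !mulr_sumr -big_split -sumrB; apply: eq_bigr => i _ /=.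
by rewrite !mxE; field.
Qed.

Lemma continuous_edot_sub w : continuous (fun u => edot (u - w) (u - w)).
Proof.
have -> : (fun u => edot (u - w) (u - w)) =
    (fun u => \sum_(i <- index_enum _) (u 0 i - w 0 i) ^+ 2).
  by apply/funext => u; apply: eq_bigr => i _; rewrite !mxE expr2.
by apply: continuous_sum_sqr_sub => i; exact: coord_continuous.
Qed.

Lemma compact_edot_le w r : compact [set u | edot (u - w) (u - w) <= r].
Proof.
(* For a coordinate difference t, the bounds t^2 <= r and (t + 1)^2, (t - 1)^2 >= 0 give |t| <= (r +
   1) / 2, so this box contains the ball and no square root of [r] is needed. *)
pose S i := `[w ord0 i - (r + 1), w ord0 i + (r + 1)]%classic.
apply: (@subclosed_compact _ _ [set v : 'rV[R]_n | forall i, S i (v ord0 i)]).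
- have -> : [set u | edot (u - w) (u - w) <= r] =
      (fun u => edot (u - w) (u - w)) @^-1` [set t | t <= r] by [].
  by apply: closed_comp; [move=> u _; exact: continuous_edot_sub|exact: closed_le].
- by apply: rV_compact => i; exact: segment_compact.
- move=> u /= ur i; rewrite /S /= in_itv /=.
  have := le_trans (edot_coord_le (u - w) i) ur; rewrite !mxE => {}ur.
  apply/andP; split.
    by have := sqr_ge0 (u 0 i - w 0 i + 1); nra.
  by have := sqr_ge0 (u 0 i - w 0 i - 1); nra.
Qed.

Lemma is_projP C y x :
  is_proj C y x <->
  C x /\ forall z, C z -> edot (x - y) (x - y) <= edot (z - y) (z - y).
Proof.
rewrite /is_proj; split=> -[Cx].
- move=> xinf; split=> // z Cz; rewrite -ler_sqrt ?edot_ge0//.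
  rewrite -[leLHS]/(enorm (x - y)) xinf; apply: ge_inf; last by exists z.
  by exists 0 => _ [v _ <-]; exact: sqrtr_ge0.
- move=> xmin; split=> //; apply/eqP; rewrite eq_le; apply/andP; split.
    apply: lb_le_inf; first by exists (enorm (x - y)), x.
    by move=> _ [v Cv <-]; rewrite ler_sqrt ?edot_ge0 ?xmin.
  apply: ge_inf; last by exists x.
  by exists 0 => _ [v _ <-]; exact: sqrtr_ge0.
Qed.

Lemma is_proj_unique C y x x' :
  convex_set C -> is_proj C y x -> is_proj C y x' -> x = x'.
Proof.
move=> cC /is_projP[Cx xmin] /is_projP[Cx' x'min].
have Cm : C (2^-1 *: x + 2^-1 *: x').
  have h0 : (0 : R) <= 2^-1 by rewrite invr_ge0.
  have h1 : (2^-1 : R) <= 1 by rewrite invf_le1 ?ler1n.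
  have -> : 2^-1 *: x + 2^-1 *: x' =
      conv (Itv01 h0 h1) (x : convex_lmodType 'rV[R]_n) x'.
    by congr (_ + _ *: _); change (2^-1 = 1 - 2^-1 :> R); field.
  by apply/set_mem/cC; apply/mem_set.
apply/eqP; rewrite -subr_eq0; apply/eqP; apply: edot_le0_eq0.
(* Neither [x] nor [x'] is farther from [y] than their midpoint, so the identity forces |x - x'|^2
   <= 0. *)
have := edot_midpoint x x' y.
have := xmin _ Cm; have := x'min _ Cm; lra.
Qed.

Lemma is_proj_exists C y : C !=set0 -> closed C -> exists x, is_proj C y x.
Proof.
move=> [c Cc] clC.
pose g u := edot (u - y) (u - y).
(* Points of [C] farther from [y] than [c] cannot compete, so minimising over a compact piece of [C]
   suffices. *)
have [|||x] := @EVT_min_rV R n g ([set u | g u <= g c] `&` C).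
- by exists c; split => /=.
- by apply: compact_closedI => //; exact: compact_edot_le.
- by apply: continuous_subspaceT; exact: continuous_edot_sub.
- rewrite inE => -[/= xc Cx] xmin; exists x; apply/is_projP; split=> // z Cz.
  have [zc|cz] := leP (g z) (g c); first by apply: xmin; rewrite inE.
  exact: le_trans xc (ltW cz).
Qed.

Lemma proj_is_proj C y : C !=set0 -> closed C -> is_proj C y (proj C y).
Proof. by move=> C0 clC; have [x] := is_proj_exists y C0 clC; exact: xgetI. Qed.

(** If [g p < a], semicontinuity keeps [g] below [a] on [A] near [p], yet the tail of [u], where
    [a <= g], meets every neighbourhood of [p]. *)
Lemma cluster_usc_ge (A : set 'rV[R]_n) (g : 'rV[R]_n -> R) (u : nat -> 'rV[R]_n)
    (p : 'rV[R]_n) (a : R) :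
  usc_on A g -> (forall k, A (u k)) -> A p -> cluster (u @ \oo) p ->
  (\forall k \near \oo, a <= g (u k)) -> a <= g p.
Proof.
move=> gA uA Ap clp agu; rewrite leNgt; apply/negP => gpa.
have uAg : (u @ \oo) [set z | A z /\ a <= g z].
  by apply: filterS agu => k agk; split.
have [z [[Az +] /(_ Az)]] := clp _ _ uAg (gA _ Ap _ gpa).
by rewrite leNgt => /negP.
Qed.

Lemma within_continuous_usc (A : set 'rV[R]_n) (g : 'rV[R]_n -> R) :
  {within A, continuous g} -> usc_on A g.
Proof.
move=> /subspace_continuousP gA x Ax a gxa.
exact: (gA x Ax _ (lt_nbhsl gxa)).
Qed.

Lemma cvg_of_unique_cluster (u : nat -> 'rV[R]_n) (s : 'rV[R]_n) (r : R) :
  (forall k, edot (u k - s) (u k - s) <= r) ->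
  (forall p, cluster (u @ \oo) p -> p = s) -> u @ \oo --> s.
Proof.
move=> ur us.
(* Radius [r + 1] rather than [r] makes the compact ball a neighbourhood of [s] even when
   [r = 0]. *)
have cV := @compact_edot_le s (r + 1).
have FV : (u @ \oo) [set v | edot (v - s) (v - s) <= r + 1].
  by exists 0%N => // k _ /=; have := ur k; lra.
apply: (compact_cluster_set1 _ cV) => //.
- have r0 : 0 <= r by exact: le_trans (edot_ge0 _) (ur 0%N).
  have ss : edot (s - s) (s - s) < r + 1.
    by rewrite subrr /edot big1 ?ltr_wpDl// => i _; rewrite mxE mul0r.
  exact: filterS (fun v => @ltW _ _ _ _) (continuous_edot_sub (lt_nbhsl ss)).
- apply/seteqP; split=> [p /us//|_ ->].
  by have [p [_ clp]] := cV _ _ FV; rewrite -(us p clp).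
Qed.

End Euclidean.

Theorem theorem6 (R : realType) (n : nat) (C : set 'rV[R]_n)
    (K : 'rV[R]_n -> set 'rV[R]_n) (f : 'rV[R]_n -> 'rV[R]_n -> R)
    (gamma : nat -> R) (y0 : 'rV[R]_n) (y_ : nat -> 'rV[R]_n) :
  let A := closed_convex_hull (Kimage C K) in
  C !=set0 -> closed C -> convex_set C ->
  strictly_monotone A f ->
  assumption_A1 A f ->
  assumption_A3 A f ->
  closed_map C K -> lsc_map C K ->
  (forall x, C x -> [/\ K x !=set0, closed (K x) & convex_set (K x)]) ->
  Sstar C K f !=set0 ->
  (forall k, 0 < gamma k) -> bounded_fun gamma ->
  proximal_sequence C K f gamma y0 y_ ->
  exists ybar : 'rV[R]_n,
    [/\ y_ @ \oo --> ybar,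
        projected_solution C K f (proj C ybar)
      & forall xbar, projected_solution C K f xbar -> xbar = proj C ybar].
Proof.
move=> A C0 clC cC fmono [fusc fcont _ fdiag] _ _ _ _ [s [sK fs]] gamma_gt0 gammaB.
move=> [_ yP].
have projP y := proj_is_proj y C0 clC.
have KA : Kimage C K `<=` A.
  by apply: subset_trans (@subset_closure _ _); exact: sub_gen_smallest.
have clA : closed A by exact: closed_closure.
have As : A s by case: C0 => x Cx; apply: KA; exists x => //; exact: sK.
have uniq p : A p -> 0 <= f p s -> 0 <= f s p -> p = s.
  move=> Ap ps sp; apply/eqP; apply: contraT => /(fmono _ _ Ap As); lra.
have yK k : Kimage C K (y_ k.+1).
  by exists (proj C (y_ k)); [exact: (projP _).1|exact: (yP k).1].
pose a k := edot (y_ k - s) (y_ k - s).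
(* The point [s] is an admissible test point because it lies in every [K z]; the term in |y_{k+1} -
   y_k|^2 has a favourable sign and is dropped. *)
have step k : 0 <= 2 * f (y_ k.+1) s + gamma k * (a k - a k.+1).
  have [Cx _] := projP (y_ k).
  have /= := (yP k).2 s (sK _ Cx); rewrite /regularized.
  have := edot_polarization (y_ k) (y_ k.+1) s.
  rewrite -/(a k) -/(a k.+1).
  have := edot_ge0 (y_ k.+1 - y_ k); have := gamma_gt0 k; nra.
have fys k : f (y_ k.+1) s <= 0.
  have [->|ns] := eqVneq (y_ k.+1) s; first by rewrite fdiag.
  by have := fmono _ _ (KA _ (yK k)) As ns; have := fs _ (yK k); lra.
have a_noninc k : a k.+1 <= a k.
  by have := fys k; have := step k; have := gamma_gt0 k; nra.
have a_le k : a k <= a 0%N by elim: k => // k; exact: le_trans.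
have a_cvg : cvgn a.
  apply: nonincreasing_is_cvgn; first exact/nonincreasing_seqP.
  by exists 0 => _ [k _ <-]; exact: edot_ge0.
have da : (a k - a k.+1) @[k --> \oo] --> 0.
  rewrite -(subrr (limn a)); apply: cvgB => //.
  by rewrite (cvg_shiftS a).
have [M gammaM] : exists M, forall k, gamma k <= M.
  (* [bounded_fun] only provides bounds strictly above [M]. *)
  have [M [_ MP]] := gammaB; exists (M + 1) => k.
  by rewrite (le_trans (ler_norm _))// MP// ltrDl.
have ysP : y_ @ \oo --> s.
  (* The sequence is shifted because [y0] is arbitrary and may lie outside [A]. *)
  rewrite -cvg_shiftS; apply: (@cvg_of_unique_cluster _ _ _ _ (a 0%N)) => //.
    by move=> k; exact: a_le.
  move=> p clp.
  have yA k : A (y_ k.+1) by exact: KA.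
  have Ap : A p.
    move: clp; rewrite clusterE => clp.
    by apply: clA; apply: clp; exists 0%N => // k _; exact: yA.
  apply: uniq => //.
  (* Upper semicontinuity passes only fixed lower bounds to [p], so [- e <= f p s] is shown for each
     [e > 0]; by [step] it suffices that the decrement times [M] is eventually below [2 * e]. *)
  - apply/ler_addgt0Pr => e e0; rewrite -lerBlDr sub0r.
    apply: (cluster_usc_ge (fusc _ As) yA Ap clp).
    have da0 : M * (a k - a k.+1) @[k --> \oo] --> 0.
      by rewrite -(mulr0 M); apply: cvgM => //; exact: cvg_cst.
    have [N _ NP] := cvgr_lt _ da0 _ (mulr_gt0 (ltr0n R 2) e0).
    exists N => // k /NP /= +; have := step k.
    have : 0 <= a k - a k.+1 by rewrite subr_ge0.
    by move=> /ler_wpM2r/(_ _ _ (gammaM k)); lra.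
  - apply: (cluster_usc_ge (within_continuous_usc (fcont _ As)) yA Ap clp).
    by exists 0%N => // k _; exact: fs (yK k).
exists s; split=> //.
- have [Cx xinf] := projP s; split=> //; exists s; split=> //; first exact: sK.
  by move=> y Ky; apply: fs; exists (proj C s).
- move=> x [Cx [y [Ky xy fy]]].
  have yKC : Kimage C K y by exists x.
  (* Both inequalities are available: [s] lies in [K x], and [y] lies in the union of all values of
     [K] on [C]. *)
  have ys : y = s by apply: uniq; [exact: KA|apply: fy; exact: sK|exact: fs].
  by subst y; apply: (is_proj_unique cC _ (projP s)).
Qed.
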